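(* Let $(\lambda_1,\dots,\lambda_{12})\in\mathbb{R}^{12}$ be the coefficients of a system $$(i\partial_t+\partial_x^2)u_j=F_j(u_1,u_2),\quad j=1,2,$$ with unknown $(u_1,u_2)$, where $F_1,F_2$ are given in the context, and suppose that the associated matrix $\mathscr{A}$ satisfies: there exists $k>0$ such that $W(-k^2,\mathscr{A}^2)\cap\mathcal{P}_+\neq\emptyset$. Then there exists an invertible real $2\times2$ matrix $\mathscr{M}$ such that, if we introduce $(v_1,v_2)$ by $$\begin{bmatrix} v_1 \\ v_2 \end{bmatrix}=\mathscr{M}\begin{bmatrix} u_1 \\ u_2 \end{bmatrix},$$ then the system for $(v_1,v_2)$ is of the following form: $$\begin{aligned}(i\partial_t+\partial_x^2)v_1={}&(\eta_2\sinh\eta_1-\sigma\eta_3\cosh\eta_1-\eta_2\lambda_0)|v_1|^2v_1+\sinh\eta_1\,(2|v_1|^2v_2+v_1^2\overline{v_2})+\sigma\cosh\eta_1\,|v_2|^2v_2 \\ &-\lambda_0\operatorname{Re}(\overline{v_1}v_2)v_1+\mathcal{V}(v_1,v_2)v_1, \\ (i\partial_t+\partial_x^2)v_2={}&\sigma\cosh\eta_1\,|v_1|^2v_1+\sinh\eta_1\,(2v_1|v_2|^2+\overline{v_1}v_2^2)+(-\sigma\eta_2\cosh\eta_1+\eta_3\sinh\eta_1+\eta_3\lambda_0)|v_2|^2v_2 \\ &+\lambda_0\operatorname{Re}(\overline{v_1}v_2)v_2+\mathcal{V}(v_1,v_2)v_2,\end{aligned}$$ where $\sigma\in\{\pm1\}$,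 $\eta_1,\eta_2,\eta_3\in\mathbb{R}$, $\lambda_0\in\mathbb{R}$, and $\mathcal{V}(v_1,v_2)=q_1|v_1|^2+2q_2\operatorname{Re}(\overline{v_1}v_2)+q_3|v_2|^2$ with $q_1,q_2,q_3\in\mathbb{R}$ is a real-valued quadratic potential. The matrix-vector representation of this system for $(v_1,v_2)$ is $$\begin{bmatrix} \sinh\eta_1 & -\eta_2\sinh\eta_1+\sigma\eta_3\cosh\eta_1+\eta_2\lambda_0 & -\sigma\cosh\eta_1 \\ 0 & \lambda_0 & 0 \\ \sigma\cosh\eta_1 & -\sigma\eta_2\cosh\eta_1+\eta_3\sinh\eta_1+\eta_3\lambda_0 & -\sinh\eta_1 \end{bmatrix},\qquad\begin{bmatrix} q_1 \\ q_2 \\ q_3 \end{bmatrix}.$$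
   Context: For $(\lambda_1,\dots,\lambda_{12})\in\mathbb{R}^{12}$ the nonlinearities are $$F_1(u_1,u_2)=\lambda_1|u_1|^2u_1+\lambda_2|u_1|^2u_2+\lambda_3u_1^2\overline{u_2}+\lambda_4|u_2|^2u_1+\lambda_5u_2^2\overline{u_1}+\lambda_6|u_2|^2u_2,$$ $$F_2(u_1,u_2)=\lambda_7|u_1|^2u_1+\lambda_8|u_1|^2u_2+\lambda_9u_1^2\overline{u_2}+\lambda_{10}|u_2|^2u_1+\lambda_{11}u_2^2\overline{u_1}+\lambda_{12}|u_2|^2u_2.$$ The matrix-vector representation of the system with these coefficients is the pair $(\mathscr{A},\mathscr{V})\in M_3(\mathbb{R})\times\mathbb{R}^3$ given by $$\mathscr{A}=\begin{bmatrix} \lambda_2-\lambda_3 & -\lambda_1+\lambda_8-\lambda_9 & -\lambda_7 \\ \lambda_5 & -\lambda_3+\lambda_{11} & -\lambda_9 \\ \lambda_6 & -\lambda_4+\lambda_5+\lambda_{12} & -\lambda_{10}+\lambda_{11} \end{bmatrix},\qquad\mathscr{V}=\begin{bmatrix} \lambda_8-2\lambda_9 \\ \tfrac12(-\lambda_2+2\lambda_3-\lambda_{10}+2\lambda_{11}) \\ \lambda_4-2\lambda_5 \end{bmatrix}.$$ For $\mathscr{G}\in M_3(\mathbb{R})$ and $\lambda\in\mathbb{R}$, $W(\lambda,\mathscr{G}):=\ker(\mathscr{G}-\lambda I)\subset\mathbb{R}^3$, and $\mathcal{P}_+:=\{(a,b,c)\in\mathbb{R}^3: ac-b^2>0\}$.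 Under a real invertible linear change of unknowns the system for $(v_1,v_2)$ is again a system of the same type (with other real coefficients), and its matrix-vector representation is the pair computed from those coefficients. *)

(* Defs.v *)
From HB Require Import structures.
From mathcomp Require Import all_boot all_order all_algebra.
From mathcomp Require Import all_classical all_reals all_analysis.
From mathcomp Require Import complex.

Set Implicit Arguments.
Unset Strict Implicit.
Unset Printing Implicit Defensive.

Import Order.TTheory GRing.Theory Num.Theory.
Import numFieldNormedType.Exports.

Local Open Scope classical_set_scope.
Local Open Scope ring_scope.
Local Open Scope complex_scope.

Definition sinh (R : realType) (x : R) : R := (expR x - expR (- x)) / 2.
Definition cosh (R : realType) (x : R) : R := (expR x + expR (- x)) / 2.

Definition mx3 (R : realType) (a11 a12 a13 a21 a22 a23 a31 a32 a33 : R) :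
    'M[R]_3 :=
  \matrix_(i < 3, j < 3)
    nth 0 (nth [::] [:: [:: a11; a12; a13];
                        [:: a21; a22; a23];
                        [:: a31; a32; a33]] i) j.

Definition col3 (R : realType) (a b c : R) : 'cV[R]_3 :=
  \col_(i < 3) nth 0 [:: a; b; c] i.

Record coeffs (R : Type) := Coeffs {
  lam1 : R; lam2 : R; lam3 : R; lam4 : R; lam5 : R; lam6 : R;
  lam7 : R; lam8 : R; lam9 : R; lam10 : R; lam11 : R; lam12 : R }.

(* The six gauge-invariant cubic monomials, in the order used for both F_1 and
   F_2. *)
Definition cubic (R : realType) (a b c d e f : R) (u1 u2 : R[i]) : R[i] :=
    a%:C * `|u1| ^+ 2 * u1 + b%:C * `|u1| ^+ 2 * u2 + c%:C * u1 ^+ 2 * conjc u2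
  + d%:C * `|u2| ^+ 2 * u1 + e%:C * u2 ^+ 2 * conjc u1 + f%:C * `|u2| ^+ 2 * u2.

Definition F1 (R : realType) (l : coeffs R) : R[i] -> R[i] -> R[i] :=
  cubic (lam1 l) (lam2 l) (lam3 l) (lam4 l) (lam5 l) (lam6 l).
Definition F2 (R : realType) (l : coeffs R) : R[i] -> R[i] -> R[i] :=
  cubic (lam7 l) (lam8 l) (lam9 l) (lam10 l) (lam11 l) (lam12 l).

Definition repA (R : realType) (l : coeffs R) : 'M[R]_3 :=
  mx3 (lam2 l - lam3 l) (- lam1 l + lam8 l - lam9 l)  (- lam7 l)
      (lam5 l)          (- lam3 l + lam11 l)          (- lam9 l)
      (lam6 l)          (- lam4 l + lam5 l + lam12 l) (- lam10 l + lam11 l).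

Definition repV (R : realType) (l : coeffs R) : 'cV[R]_3 :=
  col3 (lam8 l - 2 * lam9 l)
       (2^-1 * (- lam2 l + 2 * lam3 l - lam10 l + 2 * lam11 l))
       (lam4 l - 2 * lam5 l).

Definition W (R : realType) (a : R) (G : 'M[R]_3) : set 'cV[R]_3 :=
  [set w | (G - a%:M) *m w = 0].

Definition Pplus (R : realType) : set 'cV[R]_3 :=
  [set w | exists a b c : R, w = col3 a b c /\ 0 < a * c - b ^+ 2].

(* Differentiation of complex-valued functions of a real variable is taken
   componentwise, since R[i] is not a normed module over R in the library. *)
Definition cderivable (R : realType) (f : R -> R[i]) (x : R) : Prop :=
  derivable (fun y => complex.Re (f y)) x 1 /\ derivable (fun y => complex.Im (f y)) x 1.

Definition cderive (R : realType) (f : R -> R[i]) (x : R) : R[i] :=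
  derive1 (fun y => complex.Re (f y)) x +i* derive1 (fun y => complex.Im (f y)) x.

Definition cderivable2 (R : realType) (f : R -> R[i]) (x : R) : Prop :=
  (\forall y \near x, cderivable f y) /\ cderivable (cderive f) x.

(* [solves_at G1 G2 u1 u2 t x]: (u1, u2) is a classical solution of
   (i d_t + d_x^2) u_j = G_j(u1, u2), j = 1, 2, at the point (t, x). *)
Definition solves_at (R : realType) (G1 G2 : R[i] -> R[i] -> R[i])
    (u1 u2 : R -> R -> R[i]) (t x : R) : Prop :=
  [/\ cderivable (u1 ^~ x) t /\ cderivable2 (u1 t) x,
      cderivable (u2 ^~ x) t /\ cderivable2 (u2 t) x,
      'i%C * cderive (u1 ^~ x) t + cderive (cderive (u1 t)) x
        = G1 (u1 t x) (u2 t x) &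
      'i%C * cderive (u2 ^~ x) t + cderive (cderive (u2 t)) x
        = G2 (u1 t x) (u2 t x)].

Definition lin (R : realType) (M : 'M[R]_2) (j : 'I_2) (z1 z2 : R[i]) : R[i] :=
  (M j 0)%:C * z1 + (M j 1)%:C * z2.

(* Under (v1, v2) = M (u1, u2), the system with nonlinearities H1, H2 becomes
   the one with nonlinearities G1, G2: the first clause is about classical
   solutions, point by point; the second says that M H(u) = G(M u), which also
   covers weaker notions of solution because M is constant. *)
Definition transformed_system (R : realType) (M : 'M[R]_2)
    (H1 H2 G1 G2 : R[i] -> R[i] -> R[i]) : Prop :=
  (forall (u1 u2 : R -> R -> R[i]) (t x : R),
     solves_at H1 H2 u1 u2 t x <->
     solves_at G1 G2 (fun s y => lin M 0 (u1 s y) (u2 s y))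
                     (fun s y => lin M 1 (u1 s y) (u2 s y)) t x) /\
  (forall z1 z2 : R[i],
     G1 (lin M 0 z1 z2) (lin M 1 z1 z2) = lin M 0 (H1 z1 z2) (H2 z1 z2) /\
     G2 (lin M 0 z1 z2) (lin M 1 z1 z2) = lin M 1 (H1 z1 z2) (H2 z1 z2)).

Definition potential (R : realType) (q1 q2 q3 : R) (v1 v2 : R[i]) : R[i] :=
  q1%:C * `|v1| ^+ 2 + 2 * q2%:C * (complex.Re (conjc v1 * v2))%:C
  + q3%:C * `|v2| ^+ 2.

(* Main.v *)
Require Import Defs.
From HB Require Import structures.
From mathcomp Require Import all_boot all_order all_algebra.
From mathcomp Require Import all_classical all_reals all_analysis.
From mathcomp Require Import complex.
From mathcomp Require Import ring lra.

Set Implicit Arguments.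
Unset Strict Implicit.
Unset Printing Implicit Defensive.

Import Order.TTheory GRing.Theory Num.Theory.
Import numFieldNormedType.Exports.

Local Open Scope classical_set_scope.
Local Open Scope ring_scope.
Local Open Scope complex_scope.

(** A real quadratic form w in (u1, u2) evolves along i u' = F(u) by
    Im (conj u1 u2) times another quadratic form, and [repA] is the matrix of
    the map from the first form to the second ([Im_hform_F]).  This intrinsic
    description gives the transformation law: under u = N v the matrix is
    conjugated by the action of N on quadratic forms and multiplied by det N
    ([repA_intertwines]).

    The hypothesis provides a definite form w with A^2 w = - k^2 w.  Then w and
    A w span an A-invariant plane.  As w is definite, w and A w can be
    diagonalised simultaneously by a real change of unknowns ([diagonalise]);
    afterwards the invariant plane consists of the diagonal forms (a, 0, c), so
    the middle row of the matrix is (0, l0, 0), and the 2 x 2 block of A on the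
    plane squares to a negative scalar ([reduce_plane]).  Rescaling the two
    unknowns turns the block into [[p, -r], [r, -p]] with r^2 - p^2 = 1
    ([reduce_scale]), which is parametrised by p = sinh eta1 and
    r = sigma cosh eta1.  The two remaining entries of the matrix are an
    invertible linear function of (eta2, eta3), because l0^2 + 1 is nonzero,
    and the vector part of the representation is (q1, q2, q3).  Since matrix
    and vector determine the coefficients ([rep_inj]), the system is the one in
    normal form. *)

(** * Small matrices and vectors *)

Lemma ord3P (P : 'I_3 -> Prop) : P 0 -> P 1 -> P 2%:R -> forall i, P i.
Proof.
move=> P0 P1 P2 [[|[|[|//]]] hi].
- by rewrite (_ : Ordinal hi = 0) //; apply: val_inj.
- by rewrite (_ : Ordinal hi = 1) //; apply: val_inj.
- by rewrite (_ : Ordinal hi = 2%:R) //; apply: val_inj.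
Qed.

Lemma sum_ord2 (V : zmodType) (f : 'I_2 -> V) : \sum_i f i = f 0 + f 1.
Proof.
rewrite big_ord_recl big_ord1.
by congr (_ + f _); apply: val_inj.
Qed.

Lemma sum_ord3 (V : zmodType) (f : 'I_3 -> V) :
  \sum_i f i = f 0 + f 1 + f 2%:R.
Proof.
rewrite big_ord_recl big_ord_recl big_ord1 addrA.
by congr (_ + f _ + f _); apply: val_inj.
Qed.

Lemma col3_eta (R : realType) (w : 'cV[R]_3) :
  w = col3 (w 0 0) (w 1 0) (w 2%:R 0).
Proof.
apply/matrixP => i j; rewrite (ord1 j).
by elim/ord3P: i; rewrite mxE.
Qed.

Lemma col3_inj (R : realType) (a b c a' b' c' : R) :
  col3 a b c = col3 a' b' c' -> [/\ a = a', b = b' & c = c'].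
Proof.
move=> /matrixP e.
by split; [move: (e 0 0)|move: (e 1 0)|move: (e 2%:R 0)]; rewrite !mxE.
Qed.

Lemma scale_col3 (R : realType) (s a b c : R) :
  s *: col3 a b c = col3 (s * a) (s * b) (s * c).
Proof. by apply/matrixP; elim/ord3P => j; rewrite !mxE. Qed.

Lemma mx3_eta (R : realType) (A : 'M[R]_3) :
  A = mx3 (A 0 0) (A 0 1) (A 0 2%:R) (A 1 0) (A 1 1) (A 1 2%:R)
          (A 2%:R 0) (A 2%:R 1) (A 2%:R 2%:R).
Proof. by apply/matrixP; elim/ord3P; elim/ord3P; rewrite mxE. Qed.

Lemma mul_mx_col3 (R : realType) (A : 'M[R]_3) (a b c : R) :
  A *m col3 a b c =
  col3 (A 0 0 * a + A 0 1 * b + A 0 2%:R * c)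
       (A 1 0 * a + A 1 1 * b + A 1 2%:R * c)
       (A 2%:R 0 * a + A 2%:R 1 * b + A 2%:R 2%:R * c).
Proof.
apply/matrixP => i j; rewrite (ord1 j).
by elim/ord3P: i; rewrite !mxE sum_ord3 !mxE.
Qed.

(** * Linear changes of unknowns *)

Lemma lin_mul (R : realType) (A B : 'M[R]_2) j (z1 z2 : R[i]) :
  lin (A *m B) j z1 z2 = lin A j (lin B 0 z1 z2) (lin B 1 z1 z2).
Proof.
by rewrite /lin !mxE !sum_ord2; ring.
Qed.

Lemma lin1 (R : realType) (z1 z2 : R[i]) :
  lin 1%:M 0 z1 z2 = z1 /\ lin 1%:M 1 z1 z2 = z2.
Proof. by rewrite /lin !mxE /= !rmorph0 !rmorph1; split; ring. Qed.

(** The algebraic core of a change of unknowns: a constant matrix commutes with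
    the linear part of the system, so only the nonlinearities have to match. *)
Definition intertwines (R : realType) (M : 'M[R]_2)
    (H1 H2 G1 G2 : R[i] -> R[i] -> R[i]) : Prop :=
  forall z1 z2 : R[i],
    G1 (lin M 0 z1 z2) (lin M 1 z1 z2) = lin M 0 (H1 z1 z2) (H2 z1 z2) /\
    G2 (lin M 0 z1 z2) (lin M 1 z1 z2) = lin M 1 (H1 z1 z2) (H2 z1 z2).

Section Intertwining.
Variables (R : realType).
Implicit Types (M N : 'M[R]_2) (H G K : R[i] -> R[i] -> R[i]).

Lemma linK M z1 z2 : M \in unitmx ->
  lin (invmx M) 0 (lin M 0 z1 z2) (lin M 1 z1 z2) = z1 /\
  lin (invmx M) 1 (lin M 0 z1 z2) (lin M 1 z1 z2) = z2.
Proof. by move=> uM; rewrite -!lin_mul mulVmx //; exact: lin1. Qed.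

Lemma linVK M z1 z2 : M \in unitmx ->
  lin M 0 (lin (invmx M) 0 z1 z2) (lin (invmx M) 1 z1 z2) = z1 /\
  lin M 1 (lin (invmx M) 0 z1 z2) (lin (invmx M) 1 z1 z2) = z2.
Proof. by move=> uM; rewrite -!lin_mul mulmxV //; exact: lin1. Qed.

Lemma intertwines_inv M H1 H2 G1 G2 : M \in unitmx ->
  intertwines M H1 H2 G1 G2 -> intertwines (invmx M) G1 G2 H1 H2.
Proof.
move=> uM hM z1 z2.
have [e1 e2] := linVK z1 z2 uM.
have [] := hM (lin (invmx M) 0 z1 z2) (lin (invmx M) 1 z1 z2).
by rewrite e1 e2 => -> ->; have [-> ->] := linK
  (H1 (lin (invmx M) 0 z1 z2) (lin (invmx M) 1 z1 z2))
  (H2 (lin (invmx M) 0 z1 z2) (lin (invmx M) 1 z1 z2)) uM.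
Qed.

Lemma intertwines_mul M N H1 H2 G1 G2 K1 K2 :
  intertwines N H1 H2 G1 G2 -> intertwines M G1 G2 K1 K2 ->
  intertwines (M *m N) H1 H2 K1 K2.
Proof.
move=> hN hM z1 z2; rewrite !lin_mul.
have [-> ->] := hM (lin N 0 z1 z2) (lin N 1 z1 z2).
by have [-> ->] := hN z1 z2.
Qed.

(** * Classical solutions under a constant linear change of unknowns *)

Lemma ReIm_lin M j (z1 z2 : R[i]) :
  complex.Re (lin M j z1 z2) =
    M j 0 * complex.Re z1 + M j 1 * complex.Re z2 /\
  complex.Im (lin M j z1 z2) =
    M j 0 * complex.Im z1 + M j 1 * complex.Im z2.
Proof. by case: z1 z2 => [a b] [c d] /=; split; ring. Qed.

Lemma is_derive_lincomb (a b : R) (f g : R -> R) (x : R) :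
  derivable f x 1 -> derivable g x 1 ->
  derivable (fun y => a * f y + b * g y) x 1 /\
  derive1 (fun y => a * f y + b * g y) x = a * derive1 f x + b * derive1 g x.
Proof.
move=> df dg.
have da : derivable (a \*: f) x 1 by exact: derivableZ.
have db : derivable (b \*: g) x 1 by exact: derivableZ.
rewrite !derive1E; split; first exact: derivableD.
by rewrite [LHS](deriveD da db) !deriveZ.
Qed.

Lemma cderive_lin M j (f g : R -> R[i]) (x : R) :
  cderivable f x -> cderivable g x ->
  cderivable (fun y => lin M j (f y) (g y)) x /\
  cderive (fun y => lin M j (f y) (g y)) x =
    lin M j (cderive f x) (cderive g x).
Proof.
move=> [df1 df2] [dg1 dg2].
have [d1 e1] := is_derive_lincomb (M j 0) (M j 1) df1 dg1.
have [d2 e2] := is_derive_lincomb (M j 0) (M j 1) df2 dg2.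
rewrite /cderivable /cderive.
have -> : (fun y => complex.Re (lin M j (f y) (g y))) =
    (fun y => M j 0 * complex.Re (f y) + M j 1 * complex.Re (g y)).
  by apply/funext => y; have [] := ReIm_lin M j (f y) (g y).
have -> : (fun y => complex.Im (lin M j (f y) (g y))) =
    (fun y => M j 0 * complex.Im (f y) + M j 1 * complex.Im (g y)).
  by apply/funext => y; have [] := ReIm_lin M j (f y) (g y).
split=> //; rewrite e1 e2 /lin.
by apply/eqP; rewrite eq_complex /=; apply/andP; split; apply/eqP; ring.
Qed.

(** A second derivative at [x] sees the first derivative on a neighbourhood of
    [x], where linearity gives it only up to a local equality. *)
Lemma near_cderive (f g : R -> R[i]) (x : R) :
  (\forall y \near x, f y = g y) -> cderivable g x ->
  cderivable f x /\ cderive f x = cderive g x.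
Proof.
move=> fg [dg1 dg2].
have eRe : \forall y \near x, complex.Re (f y) = complex.Re (g y).
  by apply: filterS fg => y ->.
have eIm : \forall y \near x, complex.Im (f y) = complex.Im (g y).
  by apply: filterS fg => y ->.
split.
  by split; [apply: near_eq_derivable dg1 | apply: near_eq_derivable dg2];
    [apply: filterS eRe | apply: filterS eIm] => y ->.
by rewrite /cderive !derive1E (near_eq_derive _ eRe) (near_eq_derive _ eIm).
Qed.

Lemma cderive2_lin M j (f g : R -> R[i]) (x : R) :
  cderivable2 f x -> cderivable2 g x ->
  cderivable2 (fun y => lin M j (f y) (g y)) x /\
  cderive (cderive (fun y => lin M j (f y) (g y))) x =
    lin M j (cderive (cderive f) x) (cderive (cderive g) x).
Proof.
move=> [nf df] [ng dg].
have [dl el] := cderive_lin M j df dg.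
have nl : \forall y \near x, cderive (fun y => lin M j (f y) (g y)) y =
    lin M j (cderive f y) (cderive g y).
  by apply: filterS2 nf ng => y fy gy; have [] := cderive_lin M j fy gy.
have [d e] := near_cderive nl dl.
split; last exact: etrans e el.
split; last exact: d.
by apply: filterS2 nf ng => y fy gy; have [] := cderive_lin M j fy gy.
Qed.

Lemma lin_comb M j (s z1 z2 y1 y2 : R[i]) :
  s * lin M j z1 z2 + lin M j y1 y2 = lin M j (s * z1 + y1) (s * z2 + y2).
Proof. by rewrite /lin; ring. Qed.

Lemma solves_at_lin M H1 H2 G1 G2 (u1 u2 : R -> R -> R[i]) (t x : R) :
  intertwines M H1 H2 G1 G2 -> solves_at H1 H2 u1 u2 t x ->
  solves_at G1 G2 (fun s y => lin M 0 (u1 s y) (u2 s y))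
                  (fun s y => lin M 1 (u1 s y) (u2 s y)) t x.
Proof.
move=> hM [[dt1 dx1] [dt2 dx2] e1 e2].
have [g1 g2] := hM (u1 t x) (u2 t x).
have T j := cderive_lin M j dt1 dt2.
have X j := cderive2_lin M j dx1 dx2.
have E j : 'i%C * cderive (fun s => lin M j (u1 s x) (u2 s x)) t
      + cderive (cderive (fun y => lin M j (u1 t y) (u2 t y))) x
    = lin M j (H1 (u1 t x) (u2 t x)) (H2 (u1 t x) (u2 t x)).
  by case: (T j) => _ ->; case: (X j) => _ ->; rewrite -e1 -e2; exact: lin_comb.
split.
- by split; [exact: (T 0).1 | exact: (X 0).1].
- by split; [exact: (T 1).1 | exact: (X 1).1].
- exact: etrans (E 0) (esym g1).
- exact: etrans (E 1) (esym g2).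
Qed.

(** The converse direction on solutions is the direct one for the inverse
    matrix, which intertwines the nonlinearities the other way round. *)
Lemma transformed_system_intertwines M H1 H2 G1 G2 : M \in unitmx ->
  intertwines M H1 H2 G1 G2 -> transformed_system M H1 H2 G1 G2.
Proof.
move=> uM hM; split=> // u1 u2 t x; split; first exact: solves_at_lin.
have e1 : (fun s y => lin (invmx M) 0 (lin M 0 (u1 s y) (u2 s y))
                                      (lin M 1 (u1 s y) (u2 s y))) = u1.
  apply/funext => s; apply/funext => y.
  exact: (linK (u1 s y) (u2 s y) uM).1.
have e2 : (fun s y => lin (invmx M) 1 (lin M 0 (u1 s y) (u2 s y))
                                      (lin M 1 (u1 s y) (u2 s y))) = u2.
  apply/funext => s; apply/funext => y.
  exact: (linK (u1 s y) (u2 s y) uM).2.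
by move=> /(solves_at_lin (intertwines_inv uM hM)); rewrite e1 e2.
Qed.

End Intertwining.

(** * Gauge-invariant cubic nonlinearities *)

Section Cubic.
Variable R : realType.

Definition is_cubic (f : R[i] -> R[i] -> R[i]) : Prop :=
  exists a b c d e g : R, f = cubic a b c d e g.

Lemma is_cubic_lincomb (s t : R) f g : is_cubic f -> is_cubic g ->
  is_cubic (fun z1 z2 => s%:C * f z1 z2 + t%:C * g z1 z2).
Proof.
move=> [a [b [c [d [e [h ->]]]]]] [a' [b' [c' [d' [e' [h' ->]]]]]].
exists (s * a + t * a'), (s * b + t * b'), (s * c + t * c'),
  (s * d + t * d'), (s * e + t * e'), (s * h + t * h').
by apply/funext => z1; apply/funext => z2; rewrite /cubic; ring.
Qed.

Lemma conjc_lin (a b : R) (z1 z2 : R[i]) :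
  conjc (a%:C * z1 + b%:C * z2) = a%:C * conjc z1 + b%:C * conjc z2.
Proof.
by apply/eqP; rewrite eq_complex; case: z1 z2 => [x1 y1] [x2 y2] /=;
  apply/andP; split; apply/eqP; ring.
Qed.

(** The six monomials are exactly the products of two unknowns and one
    conjugate unknown, so a product of two linear forms and one conjugate
    linear form expands in them.  This is what makes the class of systems
    stable under linear changes of unknowns. *)
Lemma is_cubic_prod (p1 p2 q1 q2 r1 r2 : R) :
  is_cubic (fun z1 z2 => (p1%:C * z1 + p2%:C * z2) * (q1%:C * z1 + q2%:C * z2)
                         * conjc (r1%:C * z1 + r2%:C * z2)).
Proof.
exists (p1 * q1 * r1), ((p1 * q2 + p2 * q1) * r1), (p1 * q1 * r2),
  ((p1 * q2 + p2 * q1) * r2), (p2 * q2 * r1), (p2 * q2 * r2).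
apply/funext => z1; apply/funext => z2; rewrite /cubic !sqr_normc.
by rewrite conjc_lin; ring.
Qed.

Lemma is_cubic_lin (N : 'M[R]_2) f : is_cubic f ->
  is_cubic (fun z1 z2 => f (lin N 0 z1 z2) (lin N 1 z1 z2)).
Proof.
move=> [a [b [c [d [e [g ->]]]]]].
have P i j k := is_cubic_prod (N i 0) (N i 1) (N j 0) (N j 1) (N k 0) (N k 1).
have := is_cubic_lincomb 1 1
  (is_cubic_lincomb 1 1 (is_cubic_lincomb a b (P 0 0 0) (P 0 1 0))
                        (is_cubic_lincomb c d (P 0 0 1) (P 0 1 1)))
  (is_cubic_lincomb e g (P 1 1 0) (P 1 1 1)).
congr is_cubic; apply/funext => z1; apply/funext => z2.
by rewrite /cubic /lin !sqr_normc rmorph1; ring.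
Qed.

Lemma conjugate_system (N : 'M[R]_2) (l : coeffs R) : N \in unitmx ->
  exists m : coeffs R, intertwines N (F1 m) (F2 m) (F1 l) (F2 l).
Proof.
move=> uN.
have cub1 : is_cubic (fun z1 z2 => F1 l (lin N 0 z1 z2) (lin N 1 z1 z2)).
  by apply: is_cubic_lin; do 6!eexists.
have cub2 : is_cubic (fun z1 z2 => F2 l (lin N 0 z1 z2) (lin N 1 z1 z2)).
  by apply: is_cubic_lin; do 6!eexists.
have cub j := is_cubic_lincomb (invmx N j 0) (invmx N j 1) cub1 cub2.
have [m1 [m2 [m3 [m4 [m5 [m6 e1]]]]]] := cub 0.
have [m7 [m8 [m9 [m10 [m11 [m12 e2]]]]]] := cub 1.
exists (Coeffs m1 m2 m3 m4 m5 m6 m7 m8 m9 m10 m11 m12) => z1 z2.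
rewrite /(F1 (Coeffs _ _ _ _ _ _ _ _ _ _ _ _))
        /(F2 (Coeffs _ _ _ _ _ _ _ _ _ _ _ _)) /= -e1 -e2.
by have [] := linVK (F1 l (lin N 0 z1 z2) (lin N 1 z1 z2))
  (F2 l (lin N 0 z1 z2) (lin N 1 z1 z2)) uN.
Qed.

(** * The matrix of a system acting on quadratic forms *)

(** The Hermitian polarisation of the real quadratic form
    w0 |z1|^2 + 2 w1 Re (conj z1 z2) + w2 |z2|^2. *)
Definition hform (w : 'cV[R]_3) (z1 z2 y1 y2 : R[i]) : R[i] :=
  (w 0 0)%:C * conjc z1 * y1
  + (w 1 0)%:C * (conjc z1 * y2 + conjc z2 * y1)
  + (w 2%:R 0)%:C * conjc z2 * y2.

Lemma hformZ (s : R) w z1 z2 y1 y2 :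
  hform (s *: w) z1 z2 y1 y2 = s%:C * hform w z1 z2 y1 y2.
Proof. by rewrite /hform !mxE; ring. Qed.

Lemma ReZ (s : R) (z : R[i]) : complex.Re (s%:C * z) = s * complex.Re z.
Proof. by case: z => x y /=; ring. Qed.

(** The intrinsic meaning of [repA].  For the ODE i u' = F(u), the left-hand
    side is half the time derivative of the quadratic form [w] along the flow;
    it always contains the factor Im (conj u1 u2), and the cofactor is again a
    quadratic form, namely [repA l *m w]. *)
Lemma Im_hform_F (l : coeffs R) w z1 z2 :
  complex.Im (hform w z1 z2 (F1 l z1 z2) (F2 l z1 z2)) =
  complex.Im (conjc z1 * z2) * complex.Re (hform (repA l *m w) z1 z2 z1 z2).
Proof.
rewrite (col3_eta w) mul_mx_col3 /hform /F1 /F2 /cubic !sqr_normc !mxE /=.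
by case: z1 z2 => [x1 y1] [x2 y2] /=; ring.
Qed.

(** The points (1, x + i) already suffice: there the factor Im (conj z1 z2) is 1
    and the form becomes a polynomial of degree at most 2 in x, whose
    coefficients determine the form. *)
Lemma hform_ext (v w : 'cV[R]_3) :
  (forall z1 z2, complex.Im (conjc z1 * z2) * complex.Re (hform v z1 z2 z1 z2)
               = complex.Im (conjc z1 * z2) * complex.Re (hform w z1 z2 z1 z2)) ->
  v = w.
Proof.
move=> e; have {}e (x : R) := e 1%:C (x +i* 1).
move: (e 0) (e 1) (e (-1)).
rewrite (col3_eta v) (col3_eta w) /hform !mxE /= => e0 e1 e2.
by congr col3; lra.
Qed.

(** The coefficients of the quadratic form [w] after the substitution
    z := N z, that is, of the symmetric matrix N^T w N. *)
Definition pullback (N : 'M[R]_2) (w : 'cV[R]_3) : 'cV[R]_3 :=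
  col3 (w 0 0 * N 0 0 ^+ 2 + 2 * w 1 0 * N 0 0 * N 1 0 + w 2%:R 0 * N 1 0 ^+ 2)
       (w 0 0 * N 0 0 * N 0 1 + w 1 0 * (N 0 0 * N 1 1 + N 0 1 * N 1 0)
         + w 2%:R 0 * N 1 0 * N 1 1)
       (w 0 0 * N 0 1 ^+ 2 + 2 * w 1 0 * N 0 1 * N 1 1 + w 2%:R 0 * N 1 1 ^+ 2).

Lemma pullbackZ N (s : R) w : pullback N (s *: w) = s *: pullback N w.
Proof. by rewrite /pullback scale_col3 !mxE; congr col3; ring. Qed.

Lemma hform_pullback N w z1 z2 y1 y2 :
  hform (pullback N w) z1 z2 y1 y2 =
  hform w (lin N 0 z1 z2) (lin N 1 z1 z2) (lin N 0 y1 y2) (lin N 1 y1 y2).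
Proof.
by rewrite /hform /pullback /lin !conjc_lin !mxE /=; ring.
Qed.

Lemma det2 (N : 'M[R]_2) : \det N = N 0 0 * N 1 1 - N 0 1 * N 1 0.
Proof.
rewrite (expand_det_row _ 0) sum_ord2 /cofactor !det_mx11 !mxE /=.
rewrite expr0 expr1 mul1r mulN1r mulrN.
by congr (_ * N _ _ - _ * N _ _); apply: val_inj.
Qed.

Lemma Im_lin (N : 'M[R]_2) (z1 z2 : R[i]) :
  complex.Im (conjc (lin N 0 z1 z2) * lin N 1 z1 z2) =
  \det N * complex.Im (conjc z1 * z2).
Proof.
by rewrite det2 /lin; case: z1 z2 => [x1 y1] [x2 y2] /=; ring.
Qed.

(** Transformation law of the matrix: compute [Im_hform_F] in both systems of
    unknowns.  Quadratic forms are pulled back, and the factor Im (conj u1 u2),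
    being alternating, is multiplied by the determinant. *)
Lemma repA_intertwines N (m l : coeffs R) w :
  intertwines N (F1 m) (F2 m) (F1 l) (F2 l) ->
  repA m *m pullback N w = \det N *: pullback N (repA l *m w).
Proof.
move=> hN; apply: hform_ext => z1 z2.
rewrite -Im_hform_F hformZ !hform_pullback.
have [<- <-] := hN z1 z2.
by rewrite Im_hform_F Im_lin ReZ; ring.
Qed.

(** * The representation determines the system *)

(** [repA] and [repV] together are an invertible linear function of the twelve
    coefficients.  A normal form can therefore be recognised from them alone. *)
Lemma rep_inj (l m : coeffs R) : repA l = repA m -> repV l = repV m -> l = m.
Proof.
case: l m => [l1 l2 l3 l4 l5 l6 l7 l8 l9 l10 l11 l12]
             [m1 m2 m3 m4 m5 m6 m7 m8 m9 m10 m11 m12] /matrixP eA /matrixP eV.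
move: (eA 0 0) (eA 0 1) (eA 0 2%:R) (eA 1 0) (eA 1 1) (eA 1 2%:R)
  (eA 2%:R 0) (eA 2%:R 1) (eA 2%:R 2%:R) (eV 0 0) (eV 1 0) (eV 2%:R 0).
rewrite !mxE /= => *.
by congr Coeffs; lra.
Qed.

End Cubic.

(** * Diagonalising the invariant plane *)

Section Reduction.
Variable R : realType.

Lemma isotropic_vector (P Q S : R) : 0 <= Q ^+ 2 - 4 * P * S ->
  exists x y : R, (x != 0) || (y != 0) /\
    P * x ^+ 2 + Q * x * y + S * y ^+ 2 = 0.
Proof.
move=> D0; have [->|P0] := eqVneq P 0.
  by exists 1, 0; rewrite oner_eq0 orTb; split=> //; ring.
pose r := Num.sqrt (Q ^+ 2 - 4 * P * S).
have r2 : r ^+ 2 = Q ^+ 2 - 4 * P * S by exact: sqr_sqrtr.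
exists (r - Q), (2 * P); rewrite mulf_neq0 ?pnatr_eq0 // orbT; split=> //.
have -> : P * (r - Q) ^+ 2 + Q * (r - Q) * (2 * P) + S * (2 * P) ^+ 2
   = P * (r ^+ 2 - (Q ^+ 2 - 4 * P * S)) by ring.
by rewrite r2; ring.
Qed.

(** P = ab' - a'b, Q = ac' - a'c and S = bc' - b'c are, up to a factor 4,
    the coefficients of the Jacobian of the two quadratic forms.  They satisfy bQ = aS + cP, hence
    ac Q^2 >= (bQ)^2 = (aS + cP)^2 >= 4 ac PS. *)
Lemma jacobian_disc_ge0 (a b c a' b' c' : R) : 0 < a * c - b ^+ 2 ->
  0 <= (a * c' - a' * c) ^+ 2
       - 4 * (a * b' - a' * b) * (b * c' - b' * c).
Proof.
move=> ac; have ac0 : 0 < a * c by nra.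
set P := a * b' - a' * b; set Q := a * c' - a' * c; set S := b * c' - b' * c.
have bQ : b * Q = a * S + c * P by rewrite /P /Q /S; ring.
have h1 : 0 <= (a * c - b ^+ 2) * Q ^+ 2 by rewrite mulr_ge0 ?sqr_ge0 ?ltW.
have h2 : 0 <= (a * S - c * P) ^+ 2 by rewrite sqr_ge0.
have e : a * c * (Q ^+ 2 - 4 * P * S) =
  (a * c - b ^+ 2) * Q ^+ 2 + (b * Q) ^+ 2 - 4 * (a * S) * (c * P) by ring.
rewrite -(pmulr_rge0 _ ac0) e bQ.
have -> : (a * c - b ^+ 2) * Q ^+ 2 + (a * S + c * P) ^+ 2 - 4 * (a * S) * (c * P)
  = (a * c - b ^+ 2) * Q ^+ 2 + (a * S - c * P) ^+ 2 by ring.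
exact: addr_ge0.
Qed.

Lemma definite_neq0 (a b c x y : R) : 0 < a * c - b ^+ 2 ->
  (x != 0) || (y != 0) -> a * x ^+ 2 + 2 * b * x * y + c * y ^+ 2 != 0.
Proof.
move=> ac xy; apply/eqP => e0.
have a0 : a != 0 by apply: contraTneq ac => ->; rewrite -leNgt; nra.
have e : (a * x + b * y) ^+ 2 + (a * c - b ^+ 2) * y ^+ 2 = 0.
  by rewrite -[RHS](mulr0 a) -e0; ring.
have y0 : y = 0.
  apply/eqP; apply: contraT => y0.
  have : 0 < (a * c - b ^+ 2) * y ^+ 2 by rewrite mulr_gt0 // exprn_even_gt0.
  by have := sqr_ge0 (a * x + b * y); lra.
move: xy e; rewrite y0 eqxx orbF => x0 /eqP.
by rewrite expr0n /= !mulr0 !addr0 sqrf_eq0 mulf_eq0 (negPf a0) (negPf x0).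
Qed.

Definition mx2 (a b c d : R) : 'M[R]_2 :=
  \matrix_(i < 2, j < 2) nth 0 (nth [::] [:: [:: a; b]; [:: c; d]] i) j.

Lemma det_mx2 a b c d : \det (mx2 a b c d) = a * d - b * c.
Proof. by rewrite det2 !mxE. Qed.

(** Simultaneous diagonalisation of a definite form and another form.  A
    nonzero root f of their Jacobian is a vector on which the two forms are
    proportional as linear functionals, so the vector orthogonal to f for the
    first form is orthogonal to f for the second one too. *)
Lemma diagonalise (a b c a' b' c' : R) : 0 < a * c - b ^+ 2 ->
  exists (N : 'M[R]_2) (x z x' z' : R),
    [/\ \det N != 0, x * z > 0, pullback N (col3 a b c) = col3 x 0 z &
        pullback N (col3 a' b' c') = col3 x' 0 z'].
Proof.
move=> ac.
have [x [y [xy0 Jxy]]] := isotropic_vector (jacobian_disc_ge0 a' b' c' ac).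
(* The second column is the first functional (ax + by, bx + cy) turned by a
   right angle; the determinant is then the value of the definite form. *)
pose N := mx2 x (- (b * x + c * y)) y (a * x + b * y).
have dN : \det N = a * x ^+ 2 + 2 * b * x * y + c * y ^+ 2.
  by rewrite det_mx2; ring.
have dN0 : \det N != 0 by rewrite dN; exact: definite_neq0.
exists N, (\det N), ((a * c - b ^+ 2) * \det N).
exists (a' * x ^+ 2 + 2 * b' * x * y + c' * y ^+ 2).
exists (a' * (b * x + c * y) ^+ 2
  - 2 * b' * (b * x + c * y) * (a * x + b * y) + c' * (a * x + b * y) ^+ 2).
split=> //.
- by rewrite mulrCA mulr_gt0 // -expr2 exprn_even_gt0.
- by rewrite /pullback !mxE /= dN; congr col3; ring.
- rewrite /pullback !mxE /=; congr col3; try ring.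
  by rewrite -Jxy; ring.
Qed.

(** The vectors w = (x, 0, z) and w' = (x', 0, z'), which [A] exchanges up to
    factors, are independent, since w' = t w would give t^2 = - k^2.  So [A]
    maps the plane of diagonal forms to itself, and its square is negative
    scalar there; a 2 x 2 block with this property is traceless. *)
Lemma invariant_plane (A : 'M[R]_3) (x z x' z' d k : R) :
  0 < k -> d != 0 -> x * z > 0 ->
  A *m col3 x 0 z = d *: col3 x' 0 z' ->
  A *m col3 x' 0 z' = (- d * k ^+ 2) *: col3 x 0 z ->
  [/\ A 1 0 = 0, A 1 2%:R = 0, A 2%:R 2%:R = - A 0 0 &
      A 0 0 ^+ 2 + A 0 2%:R * A 2%:R 0 = - (d * k) ^+ 2].
Proof.
move=> k0 d0 xz.
rewrite !mul_mx_col3 !scale_col3 => /col3_inj [e1 e2 e3] /col3_inj [e4 e5 e6].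
have x0 : x != 0 by apply: contraTneq xz => ->; rewrite mul0r ltxx.
have D0 : x * z' - x' * z != 0.
  apply/eqP => D0.
  have h2 : x * (- d * k ^+ 2 * x) = x' * (d * x').
    have -> : x * (- d * k ^+ 2 * x) =
      x * (x' * A 0 0) + x * z' * A 0 2%:R by rewrite -e4; ring.
    have -> : x * z' = x' * z by lra.
    by rewrite -e1; ring.
  have : d * (x' ^+ 2 + (k * x) ^+ 2) == 0 by apply/eqP; lra.
  rewrite mulf_eq0 (negPf d0) /= paddr_eq0 ?sqr_ge0 // => /andP[_].
  by rewrite sqrf_eq0 mulf_eq0 (negPf x0) gt_eqF.
(* Each entry is extracted by Cramer's rule from the two equations for [A]. *)
have cancel p q : (x * z' - x' * z) * p = (x * z' - x' * z) * q -> p = q.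
  exact: mulfI.
split; apply: cancel.
- transitivity (z' * (A 1 0 * x + A 1 1 * 0 + A 1 2%:R * z)
    - z * (A 1 0 * x' + A 1 1 * 0 + A 1 2%:R * z')); first by ring.
  by rewrite e2 e5; ring.
- transitivity (x * (A 1 0 * x' + A 1 1 * 0 + A 1 2%:R * z')
    - x' * (A 1 0 * x + A 1 1 * 0 + A 1 2%:R * z)); first by ring.
  by rewrite e2 e5; ring.
- transitivity (x * (A 2%:R 0 * x' + A 2%:R 1 * 0 + A 2%:R 2%:R * z')
    - x' * (A 2%:R 0 * x + A 2%:R 1 * 0 + A 2%:R 2%:R * z)); first by ring.
  transitivity (- (z' * (A 0 0 * x + A 0 1 * 0 + A 0 2%:R * z)
    - z * (A 0 0 * x' + A 0 1 * 0 + A 0 2%:R * z'))); last by ring.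
  by rewrite e1 e3 e4 e6; ring.
- transitivity (z' * (A 0 0 * (A 0 0 * x + A 0 1 * 0 + A 0 2%:R * z)
        + A 0 2%:R * (A 2%:R 0 * x + A 2%:R 1 * 0 + A 2%:R 2%:R * z))
    - z * (A 0 0 * (A 0 0 * x' + A 0 1 * 0 + A 0 2%:R * z')
        + A 0 2%:R * (A 2%:R 0 * x' + A 2%:R 1 * 0 + A 2%:R 2%:R * z'))).
    by ring.
  rewrite e1 e3 e4 e6.
  transitivity (z' * d * (A 0 0 * x' + A 0 1 * 0 + A 0 2%:R * z')
    + z * d * k ^+ 2 * (A 0 0 * x + A 0 1 * 0 + A 0 2%:R * z)); first by ring.
  by rewrite e1 e4; ring.
Qed.

Lemma reduce_plane (l : coeffs R) (k : R) : 0 < k ->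
  W (- k ^+ 2) (repA l ^+ 2) `&` @Pplus R !=set0 ->
  exists (N : 'M[R]_2) (m : coeffs R) (h : R),
    [/\ N \in unitmx, intertwines N (F1 m) (F2 m) (F1 l) (F2 l),
        h != 0,
        [/\ repA m 1 0 = 0, repA m 1 2%:R = 0 &
            repA m 2%:R 2%:R = - repA m 0 0] &
        repA m 0 0 ^+ 2 + repA m 0 2%:R * repA m 2%:R 0 = - h ^+ 2].
Proof.
move=> k0 [w [hW [a [b [c [ew ac]]]]]].
have A2w : repA l *m (repA l *m w) = - k ^+ 2 *: w.
  move: hW; rewrite /W /= mulmxBl mul_scalar_mx => /eqP.
  by rewrite subr_eq0 expr2 -mulmxE -mulmxA => /eqP.
have [N [x [z [x' [z' [dN xz pw pw']]]]]] := diagonalise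
  ((repA l *m w) 0 0) ((repA l *m w) 1 0) ((repA l *m w) 2%:R 0) ac.
move: pw pw'; rewrite -ew -col3_eta => pw pw'.
have uN : N \in unitmx by rewrite unitmxE unitfE.
have [m hm] := conjugate_system l uN.
have := repA_intertwines w hm; rewrite pw pw' => r1.
have := repA_intertwines (repA l *m w) hm; rewrite A2w pullbackZ pw pw' => r2.
have [|? ? ? ?] := invariant_plane k0 dN xz r1.
  by rewrite r2 scalerA mulrN mulNr.
exists N, m, (\det N * k); split=> //.
by rewrite mulf_neq0 // gt_eqF.
Qed.

(** * Scaling the unknowns *)

Lemma repA_diag (s t : R) (m n : coeffs R) : s != 0 -> t != 0 ->
  intertwines (mx2 s 0 0 t) (F1 n) (F2 n) (F1 m) (F2 m) ->
  repA n =
  mx3 (s * t * repA m 0 0)      (s ^+ 2 * repA m 0 1)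
      (s ^+ 3 / t * repA m 0 2%:R)
      (t ^+ 2 * repA m 1 0)     (s * t * repA m 1 1)
      (s ^+ 2 * repA m 1 2%:R)
      (t ^+ 3 / s * repA m 2%:R 0) (t ^+ 2 * repA m 2%:R 1)
      (s * t * repA m 2%:R 2%:R).
Proof.
move=> s0 t0 hN.
have e a b c := repA_intertwines (col3 a b c) hN.
have pd a b c : pullback (mx2 s 0 0 t) (col3 a b c) =
   col3 (s ^+ 2 * a) (s * t * b) (t ^+ 2 * c).
  by rewrite /pullback !mxE /=; congr col3; ring.
have dN : \det (mx2 s 0 0 t) = s * t by rewrite det_mx2; ring.
have [s2 t2 st] : [/\ s ^+ 2 != 0, t ^+ 2 != 0 & s * t != 0].
  by rewrite !expf_neq0 ?mulf_neq0.
move: (e 1 0 0) (e 0 1 0) (e 0 0 1).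
rewrite !(pd, mul_mx_col3, dN, scale_col3, mulr0, mulr1, addr0, add0r).
move=> /col3_inj [e1 e2 e3] /col3_inj [e4 e5 e6] /col3_inj [e7 e8 e9].
rewrite [LHS]mx3_eta; congr mx3.
- by apply: (mulIf s2); rewrite e1; ring.
- by apply: (mulIf st); rewrite e4; ring.
- by apply: (mulIf t2); rewrite e7; field.
- by apply: (mulIf s2); rewrite e2; ring.
- by apply: (mulIf st); rewrite e5; ring.
- by apply: (mulIf t2); rewrite e8; ring.
- by apply: (mulIf s2); rewrite e3; field.
- by apply: (mulIf st); rewrite e6; ring.
- by apply: (mulIf t2); rewrite e9; ring.
Qed.

(** Two positive scalings leave two degrees of freedom in the block
    [[p, q], [r, -p]]: their product st normalises the determinant to 1, and
    their ratio t/s makes the off-diagonal entries opposite to each other. *)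
Lemma reduce_scale (m : coeffs R) (h : R) : h != 0 ->
  repA m 1 0 = 0 -> repA m 1 2%:R = 0 -> repA m 2%:R 2%:R = - repA m 0 0 ->
  repA m 0 0 ^+ 2 + repA m 0 2%:R * repA m 2%:R 0 = - h ^+ 2 ->
  exists (N : 'M[R]_2) (n : coeffs R) (p r : R),
    [/\ N \in unitmx, intertwines N (F1 n) (F2 n) (F1 m) (F2 m),
        r ^+ 2 = 1 + p ^+ 2 &
        repA n = mx3 p (repA n 0 1) (- r) 0 (repA n 1 1) 0
                     r (repA n 2%:R 1) (- p)].
Proof.
move=> h0 m10 m12 m22.
set p := repA m 0 0; set q := repA m 0 2%:R; set r := repA m 2%:R 0 => mpqr.
have h20 : 0 < h ^+ 2 by rewrite exprn_even_gt0.
have qr : 0 < - q * r by have := sqr_ge0 p; lra.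
have r0 : r != 0 by apply: contraTneq qr => ->; rewrite mulr0 ltxx.
have qr' : 0 < - q / r.
  have -> : - q / r = - q * r / r ^+ 2 by field.
  by rewrite divr_gt0 // exprn_even_gt0.
have nh0 : 0 < `|h| by rewrite normr_gt0.
(* [tau] is the ratio t/s: equalising (s^3/t) q and - (t^3/s) r asks for
   (t/s)^4 = - q/r, and then s t = tau s^2 has to be 1/|h|. *)
pose tau := Num.sqrt (Num.sqrt (- q / r)).
have tau0 : 0 < tau by rewrite !sqrtr_gt0.
have tau4 : q = - (tau ^+ 4 * r).
  by rewrite (exprM tau 2 2) !sqr_sqrtr ?ltW ?sqrtr_gt0 //; field.
pose s := Num.sqrt ((`|h| * tau)^-1).
have s0 : 0 < s by rewrite sqrtr_gt0 invr_gt0 mulr_gt0.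
have s2 : s ^+ 2 = (`|h| * tau)^-1.
  by rewrite sqr_sqrtr // ltW // invr_gt0 mulr_gt0.
have hst : (s * (tau * s)) ^+ 2 * h ^+ 2 = 1.
  rewrite -(real_normK (num_real h)) -exprMn.
  have -> : s * (tau * s) = s ^+ 2 * tau by ring.
  by rewrite s2; field; rewrite !gt_eqF.
have t0 : 0 < tau * s by rewrite mulr_gt0.
pose N := mx2 s 0 0 (tau * s).
have uN : N \in unitmx.
  by rewrite unitmxE unitfE det_mx2 mulr0 subr0 mulf_neq0 ?gt_eqF.
have [n hn] := conjugate_system m uN.
have An := repA_diag (lt0r_neq0 s0) (lt0r_neq0 t0) hn.
exists N, n, (s * (tau * s) * p), ((tau * s) ^+ 3 / s * r).
have e02 : s ^+ 3 / (tau * s) * q = - ((tau * s) ^+ 3 / s * r).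
  by rewrite tau4; field; rewrite !gt_eqF.
split=> //.
- have -> : ((tau * s) ^+ 3 / s * r) ^+ 2 =
      - ((s * (tau * s)) ^+ 2 * (q * r)).
    by rewrite tau4; field; rewrite gt_eqF.
  have -> : q * r = - h ^+ 2 - p ^+ 2 by rewrite -mpqr; ring.
  by rewrite -hst; ring.
- by rewrite {1}An m10 m12 m22 -/p -/q -/r e02 !mulr0 mulrN An !mxE.
Qed.

(** * Identification of the normal form *)

(** The coefficients of the target system, with [sh] for sinh eta1 and [sch] for
    sigma cosh eta1; the terms in [l0 / 2] come from expanding
    Re (conj v1 v2) v_j into monomials. *)
Definition normal_coeffs (sh sch eta2 eta3 l0 q1 q2 q3 : R) : coeffs R :=
  {| lam1 := eta2 * sh - sch * eta3 - eta2 * l0 + q1;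
     lam2 := 2 * sh - l0 / 2 + q2;
     lam3 := sh - l0 / 2 + q2;
     lam4 := q3;
     lam5 := 0;
     lam6 := sch;
     lam7 := sch;
     lam8 := q1;
     lam9 := 0;
     lam10 := 2 * sh + l0 / 2 + q2;
     lam11 := sh + l0 / 2 + q2;
     lam12 := - (sch * eta2) + eta3 * sh + eta3 * l0 + q3 |}.

Lemma repA_normal sh sch eta2 eta3 l0 q1 q2 q3 :
  repA (normal_coeffs sh sch eta2 eta3 l0 q1 q2 q3) =
  mx3 sh (- eta2 * sh + sch * eta3 + eta2 * l0) (- sch)
      0 l0 0
      sch (- (sch * eta2) + eta3 * sh + eta3 * l0) (- sh).
Proof. by rewrite /repA /=; congr mx3; field. Qed.

Lemma repV_normal sh sch eta2 eta3 l0 q1 q2 q3 :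
  repV (normal_coeffs sh sch eta2 eta3 l0 q1 q2 q3) = col3 q1 q2 q3.
Proof. by rewrite /repV /=; congr col3; field. Qed.

(** The two middle entries of the first and third rows are linear in
    (eta2, eta3), with determinant l0^2 - p^2 + r^2 = l0^2 + 1, so they can be
    prescribed freely; [rep_inj] then concludes. *)
Lemma normal_coeffs_ex (n : coeffs R) (p r : R) : r ^+ 2 = 1 + p ^+ 2 ->
  repA n = mx3 p (repA n 0 1) (- r) 0 (repA n 1 1) 0
               r (repA n 2%:R 1) (- p) ->
  exists eta2 eta3 l0 q1 q2 q3, n = normal_coeffs p r eta2 eta3 l0 q1 q2 q3.
Proof.
set x := repA n 0 1; set l0 := repA n 1 1; set y := repA n 2%:R 1 => rp An.
have D0 : l0 ^+ 2 + 1 != 0 by rewrite gt_eqF // ltr_wpDl ?sqr_ge0.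
exists (((p + l0) * x - r * y) / (l0 ^+ 2 + 1)).
exists (((l0 - p) * y + r * x) / (l0 ^+ 2 + 1)).
exists l0, (repV n 0 0), (repV n 1 0), (repV n 2%:R 0).
apply: rep_inj; last by rewrite repV_normal -col3_eta.
rewrite An repA_normal.
(* In this form the two equations hold as rational identities in p and r. *)
have {}D0 : l0 ^+ 2 - p ^+ 2 + r ^+ 2 != 0.
  by rewrite rp (_ : _ - _ + _ = l0 ^+ 2 + 1) //; ring.
have -> : l0 ^+ 2 + 1 = l0 ^+ 2 - p ^+ 2 + r ^+ 2 by rewrite rp; ring.
by congr mx3; field.
Qed.

(** The hyperbola r^2 = 1 + p^2 has two branches, told apart by [sigma]; the
    parameter is eta = ln (p + |r|), the inverse hyperbolic sine of p. *)
Lemma sinh_cosh_param (p r : R) : r ^+ 2 = 1 + p ^+ 2 ->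
  exists sigma eta : R, [/\ sigma = 1 \/ sigma = - 1,
    sinh eta = p & sigma * cosh eta = r].
Proof.
move=> rp; pose u := p + `|r|.
have nr : `|r| ^+ 2 = 1 + p ^+ 2 by rewrite real_normK ?num_real.
have u0 : 0 < u.
  rewrite /u; have : - p < `|r|; last by lra.
  apply: le_lt_trans (ler_norm _) _.
  by rewrite normrN -(ltr_pXn2r (n := 2)) ?nnegrE // nr real_normK ?num_real //; lra.
have uV : u^-1 = `|r| - p.
  apply: (mulfI (lt0r_neq0 u0)); rewrite mulfV ?lt0r_neq0 //.
  have -> : u * (`|r| - p) = `|r| ^+ 2 - p ^+ 2 by rewrite /u; ring.
  by rewrite nr; ring.
have eu : expR (ln u) = u by rewrite lnK // posrE.
have sh : sinh (ln u) = p by rewrite /sinh expRN eu uV /u; field.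
have ch : cosh (ln u) = `|r| by rewrite /cosh expRN eu uV /u; field.
have [rge0|rlt0] := leP 0 r.
- by exists 1, (ln u); split=> //; [left | rewrite ch ger0_norm // mul1r].
- exists (- 1), (ln u); split=> //; first by right.
  by rewrite ch ltr0_norm // mulN1r opprK.
Qed.

End Reduction.

(** * Reduction to the normal form *)

Theorem theorem1p8 (R : realType) (l : coeffs R)
    (hA : exists k : R, 0 < k /\
            W (- k ^+ 2) (repA l ^+ 2) `&` @Pplus R !=set0) :
  exists (M : 'M[R]_2) (sigma eta1 eta2 eta3 l0 q1 q2 q3 : R),
    let G1 (v1 v2 : R[i]) : R[i] :=
        (eta2 * sinh eta1 - sigma * eta3 * cosh eta1 - eta2 * l0)%:C
          * `|v1| ^+ 2 * v1
      + (sinh eta1)%:C * (2 * `|v1| ^+ 2 * v2 + v1 ^+ 2 * conjc v2)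
      + (sigma * cosh eta1)%:C * `|v2| ^+ 2 * v2
      - l0%:C * (complex.Re (conjc v1 * v2))%:C * v1
      + potential q1 q2 q3 v1 v2 * v1 in
    let G2 (v1 v2 : R[i]) : R[i] :=
        (sigma * cosh eta1)%:C * `|v1| ^+ 2 * v1
      + (sinh eta1)%:C * (2 * v1 * `|v2| ^+ 2 + conjc v1 * v2 ^+ 2)
      + (- sigma * eta2 * cosh eta1 + eta3 * sinh eta1 + eta3 * l0)%:C
          * `|v2| ^+ 2 * v2
      + l0%:C * (complex.Re (conjc v1 * v2))%:C * v2
      + potential q1 q2 q3 v1 v2 * v2 in
    [/\ M \in unitmx,
        sigma = 1 \/ sigma = - 1,
        transformed_system M (F1 l) (F2 l) G1 G2 &
        exists m : coeffs R,
          [/\ G1 = F1 m,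
              G2 = F2 m,
              repA m =
                mx3 (sinh eta1)
                    (- eta2 * sinh eta1 + sigma * eta3 * cosh eta1 + eta2 * l0)
                    (- sigma * cosh eta1)
                    0 l0 0
                    (sigma * cosh eta1)
                    (- sigma * eta2 * cosh eta1 + eta3 * sinh eta1 + eta3 * l0)
                    (- sinh eta1) &
              repV m = col3 q1 q2 q3]].
Proof.
have [k [k0 hW]] := hA.
have [N1 [m [h [uN1 hN1 h0 [m10 m12 m22] mh]]]] := reduce_plane k0 hW.
have [N2 [n [p [r [uN2 hN2 rp An]]]]] := reduce_scale h0 m10 m12 m22 mh.
have [eta2 [eta3 [l0 [q1 [q2 [q3 en]]]]]] := normal_coeffs_ex rp An.
have [sigma [eta1 [hs sh ch]]] := sinh_cosh_param rp.
have uN : N1 *m N2 \in unitmx by rewrite unitmx_mul uN1.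
have hM := intertwines_inv uN (intertwines_mul hN2 hN1).
exists (invmx (N1 *m N2)), sigma, eta1, eta2, eta3, l0, q1, q2, q3 => G1 G2.
have ReJ (z1 z2 : R[i]) : (complex.Re (conjc z1 * z2))%:C =
    2^-1 * (conjc z1 * z2 + z1 * conjc z2).
  by rewrite ReJ_add rmorphM /= conjcK mulrC.
have ch2 : sigma * eta3 * cosh eta1 = r * eta3 by rewrite -ch; ring.
have ch3 : - sigma * eta2 * cosh eta1 = - (r * eta2) by rewrite -ch; ring.
have eG1 : G1 = F1 n.
  apply/funext => z1; apply/funext => z2.
  rewrite /G1 en /F1 /cubic /potential /= sh ch ch2 !sqr_normc ReJ.
  by field.
have eG2 : G2 = F2 n.
  apply/funext => z1; apply/funext => z2.
  rewrite /G2 en /F2 /cubic /potential /= sh ch ch3 !sqr_normc ReJ.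
  by field.
have uM : invmx (N1 *m N2) \in unitmx by rewrite unitmx_inv.
split=> //; [rewrite eG1 eG2; exact: transformed_system_intertwines uM hM|].
exists n; split=> //; last by rewrite en repV_normal.
by rewrite en repA_normal sh ch2 ch3 [- sigma * _]mulNr ch.
Qed.
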